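(* Let $n$ be a positive integer, let $M_1$ and $M_2$ be nonnegative integers, and let $S$ be an integer with $-M_1\le S\le M_2$. Then, as an identity of rational functions in the indeterminate $q$, $$ \sum_{\substack{(k_1,\dots,k_n)\in\mathbb{Z}^n\\ k_1+\dots+k_n=S}}(-1)^{(n-1)S}\, q^{\binom{n+1}{2}\sum_{i=1}^{n}k_i^2+\sum_{i=1}^{n}ik_i}\prod_{1\le i<j\le n}\left(1-q^{nk_j-nk_i+j-i}\right) \cdot\prod_{i=1}^{n}\frac{(q;q)_{M_1+M_2+i-1}}{(q;q)_{M_1+nk_i+i-1}\,(q;q)_{M_2-nk_i+n-i}} = q^{(n+1)\binom{S+1}{2}}\frac{(q;q)_{M_1+M_2}}{(q;q)_{M_1+S}\,(q;q)_{M_2-S}}. $$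
   Context: The shifted $q$-factorial is defined for integers $k$ by $(a;q)_k:=(1-a)(1-aq)\cdots(1-aq^{k-1})$ if $k>0$, $(a;q)_0:=1$, and $(a;q)_k:=\dfrac{1}{(1-a/q)(1-a/q^2)\cdots(1-aq^{k})}$ if $k<0$. Accordingly, for $k<0$ the reciprocal $1/(q;q)_k=(1-q/q)(1-q/q^2)\cdots(1-q\cdot q^{k})$ contains the factor $1-1=0$, so $1/(q;q)_k$ is understood to be $0$. Hence a summand on the left-hand side vanishes whenever some index $M_1+nk_i+i-1$ or $M_2-nk_i+n-i$ is negative, and only finitely many summands are nonzero. For an integer $S$ (possibly negative), $\binom{S+1}{2}=S(S+1)/2$. *)

(* Defs.v *)
From HB Require Import structures.
From mathcomp Require Import all_boot all_order all_algebra.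
From mathcomp Require Import boolp classical_sets functions cardinality fsbigop.

Set Implicit Arguments.
Unset Strict Implicit.
Unset Printing Implicit Defensive.

Import Order.TTheory GRing.Theory Num.Theory.

Local Open Scope ring_scope.

(* The field of rational functions over F, and its indeterminate. *)
Definition ratfun (F : fieldType) : fieldType := {fraction {poly F}}.

Definition indet (F : fieldType) : ratfun F := FracField.tofrac ('X : {poly F}).

(* (a;q)_k for k in Z. Negz m is - m.+1, so the second branch is
   1 / ((1 - a/q) ... (1 - a q^k)) with k = - m.+1. *)
Definition qpoch (K : fieldType) (a q : K) (k : int) : K :=
  match k with
  | Posz m => \prod_(0 <= j < m) (1 - a * q ^+ j)
  | Negz m => (\prod_(1 <= j < m.+2) (1 - a / q ^+ j))^-1
  end.

(* For k < 0, 1 / (a;q)_k is the product (1 - a/q) ... (1 - a q^k), also when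
   that product is 0 (as 0^-1 = 0), hence 1 / (q;q)_k = 0. *)
Lemma invr_qpoch_neg (K : fieldType) (a q : K) (m : nat) :
  (qpoch a q (Negz m))^-1 = \prod_(1 <= j < m.+2) (1 - a / q ^+ j).
Proof. exact: invrK. Qed.

Lemma invr_qpoch_qq_neg (K : fieldType) (q : K) (m : nat) :
  q != 0 -> (qpoch q q (Negz m))^-1 = 0.
Proof.
by move=> q0; rewrite invr_qpoch_neg big_ltn // expr1 divff // subrr mul0r.
Qed.

(* Main.v *)
Require Import Defs.
From HB Require Import structures.
From mathcomp Require Import all_boot all_order all_algebra.
From mathcomp Require Import perm ring zify.
From mathcomp Require Import boolp classical_sets functions cardinality fsbigop.

Set Implicit Arguments.
Unset Strict Implicit.
Unset Printing Implicit Defensive.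

Import Order.TTheory GRing.Theory Num.Theory.

Local Open Scope classical_set_scope.
Local Open Scope ring_scope.

(* The cyclic relabelling (k_1, ..., k_n) -> (k_n + 1, k_1, ..., k_(n-1))
   trades (M1, M2, S) for (M1 - 1, M2 + 1, S + 1), which reduces the identity
   to M1 = 0, where only k_i >= 0 contribute.  There, with N = M2 and the k_i
   fixed, the product over i < j is a Vandermonde determinant in the
   q^(n k_i + i - 1), so the generating function in z of the left-hand sides
   is, up to elementary factors, det (h_i (q^j u)) with z = u^n, where
   h_1, ..., h_n are the n-sections of one series sum_a w(a) u^a.  Since
   w(a + n) / w(a) is a rational function of q^a, all n sections satisfy the
   same linear q-difference equation, of order n + 1.  Let D_t be this
   determinant taken at q^t u.  The minors with columns t, ..., t + n except
   t + j then obey a two-step recursion in (t, j); iterating it from D_0 down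
   to D_(n+1) gives a linear relation between D_0, ..., D_(n+1).  It determines
   the coefficients of D_0 from the constant one, and the right-hand sides
   solve it because the two ways of splitting the product of the 1 + q^i x,
   i < n + N, give two forms of the q-Vandermonde convolution. *)

(** * Minors with one omitted column, for vectors satisfying a linear recurrence *)

Section OmittedColumn.
Variables (R : comNzRingType) (p : nat).
Implicit Types (V : nat -> 'I_p.+1 -> R) (W : 'M[R]_(p.+1, p)) (v : 'I_p.+1 -> R).

Definition omit_det V (t j : nat) : R :=
  \det (\matrix_(i < p.+1, c < p.+1) V (t + bump j c)%N i).

(* Inserting the column v into W at position a multiplies this by (-1)^a. *)
Definition col_det W v : R := \sum_i v i * ((-1) ^+ i * \det (row' i W)).

Lemma det_col_det (X : 'M[R]_p.+1) (a : 'I_p.+1) :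
  \det X = (-1) ^+ a * col_det (col' a X) (fun i => X i a).
Proof.
rewrite (expand_det_col _ a) /col_det mulr_sumr; apply: eq_bigr => i _.
by rewrite /cofactor exprD; ring.
Qed.

Lemma col_det_sum W (I : finType) (c : I -> R) (v : I -> 'I_p.+1 -> R) :
  col_det W (fun i => \sum_l c l * v l i) = \sum_l c l * col_det W (v l).
Proof.
rewrite /col_det; under eq_bigr do rewrite mulr_suml.
rewrite exchange_big; apply: eq_bigr => l _; rewrite mulr_sumr.
by apply: eq_bigr => i _; rewrite mulrA.
Qed.

Lemma col_det_eq W v v' : v =1 v' -> col_det W v = col_det W v'.
Proof. by move=> e; apply: eq_bigr => i _; rewrite e. Qed.

Lemma col_det0 W : col_det W (fun=> 0) = 0.
Proof. by rewrite /col_det big1 // => i _; rewrite mul0r. Qed.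

(** Let [W] have the columns t + 1, ..., t + p + 1 except t + 1 + j. Inserting the zero column sum_l
    c_l V(t + l) into [W] gives 0 by linearity; a term with l in 1, ..., p + 1 other than j + 1
    repeats a column of [W], so only l = 0, j + 1, p + 2 survive. *)
Lemma omit_det_rec V (t : nat) (c : nat -> R) (j : nat) :
  (j <= p)%N ->
  (forall i, \sum_(l < p.+3) c l * V (t + l)%N i = 0) ->
  c 0%N * omit_det V t j.+1 + (-1) ^+ j * (c j.+1 * omit_det V t.+1 p.+1)
  + (-1) ^+ p * (c p.+2 * omit_det V t.+1 j) = 0.
Proof.
move=> lejp rel.
pose W : 'M[R]_(p.+1, p) := \matrix_(i, c) V (t.+1 + bump j c)%N i.
pose J : 'I_p.+1 := Ordinal (lejp : (j < p.+1)%N).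
have E0 : omit_det V t j.+1 = col_det W (V t).
  rewrite /omit_det (det_col_det _ ord0) expr0 mul1r.
  have -> : col' ord0 (\matrix_(i < p.+1, c < p.+1) V (t + bump j.+1 c)%N i) = W.
    by apply/matrixP => i k; rewrite !mxE lift0 bumpS addnS addSn.
  by apply: col_det_eq => i; rewrite mxE addn0.
have Emax : omit_det V t.+1 j = (-1) ^+ p * col_det W (V (t + p.+2)%N).
  rewrite /omit_det (det_col_det _ ord_max).
  have -> : col' ord_max (\matrix_(i < p.+1, c < p.+1) V (t.+1 + bump j c)%N i) = W.
    by apply/matrixP => i k; rewrite !mxE lift_max.
  by congr (_ * _); apply: col_det_eq => i; rewrite mxE /= /bump lejp addSnnS.
have WJ : forall X : 'M[R]_p.+1,
    (forall i l, l != J -> X i l = V (t.+1 + l)%N i) -> col' J X = W.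
  move=> X HX; apply/matrixP => i k; rewrite !mxE HX //.
  by rewrite eq_sym neq_lift.
have EJ : omit_det V t.+1 p.+1 = (-1) ^+ j * col_det W (V (t + j.+1)%N).
  rewrite /omit_det (det_col_det _ J) WJ.
    congr (_ * _); apply: col_det_eq => i; rewrite mxE /=.
    by rewrite /bump leqNgt (leq_ltn_trans lejp) // addSnnS.
  by move=> i l _; rewrite mxE /bump leqNgt ltn_ord.
have Eother (l : 'I_p.+1) : l != J -> col_det W (V (t + l.+1)%N) = 0.
  move=> lJ.
  pose X : 'M[R]_p.+1 := \matrix_(i, k) V (t.+1 + (if k == J then l else k))%N i.
  have X0 : \det X = 0.
    rewrite -det_tr (determinant_alternate lJ) // => k.
    by rewrite !mxE eqxx (negPf lJ).
  move: X0; rewrite (det_col_det _ J) WJ => [|i k kJ]; last by rewrite mxE (negPf kJ).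
  move/(congr1 (fun x => (-1) ^+ j * x)); rewrite mulr0 mulrA -exprD -signr_odd oddD addbb mul1r.
  by move=> <-; apply: col_det_eq => i; rewrite mxE eqxx addSnnS.
have := col_det0 W.
rewrite (col_det_eq _ (v' := fun i => \sum_(l < p.+3) c l * V (t + l)%N i)) //.
rewrite (col_det_sum W (fun l : 'I_p.+3 => c l) (fun l : 'I_p.+3 => V (t + l)%N)).
rewrite big_ord_recl big_ord_recr /= (bigD1 J) //= big1 ?addr0 => [|l lJ]; last first.
  by rewrite Eother ?mulr0.
rewrite addn0 E0 Emax EJ /bump /= !add1n => <-.
have sq k : (-1) ^+ k * (-1) ^+ k = 1 :> R.
  by rewrite -exprD -signr_odd oddD addbb.
rewrite [X in _ + X + _ = _](_ : _ =
  (-1) ^+ j * (-1) ^+ j * (c j.+1 * col_det W (V (t + j.+1)%N))); last by ring.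
rewrite [X in _ + X = _](_ : _ =
  (-1) ^+ p * (-1) ^+ p * (c p.+2 * col_det W (V (t + p.+2)%N))); last by ring.
by rewrite !sq !mul1r addrA.
Qed.
End OmittedColumn.

(** * The q-binomial theorem, q-Vandermonde convolutions and reciprocal q-factorials *)

Section QBinomialProduct.
Variables (K : fieldType) (q : K).

Definition qprod (a : K) (n : nat) : {poly K} :=
  \prod_(i < n) (1 + (a * q ^+ i) *: 'X).

(* This is q^(s choose 2) times the Gaussian binomial coefficient [n, s]. *)
Definition qbin (n s : nat) : K := (qprod 1 n)`_s.

Definition qroots (a : K) (n : nat) : {poly K} :=
  \prod_(l < n) ('X - (a * q ^+ l)%:P).

Lemma coef_qprod0 a n : (qprod a n)`_0 = 1.
Proof.
elim: n => [|n IH]; first by rewrite /qprod big_ord0 coef1.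
rewrite /qprod big_ord_recr /= -/(qprod a n) mulrDr mulr1 -scalerAr.
by rewrite coefD coefZ coefMX eqxx mulr0 addr0 IH.
Qed.

Lemma coef_qprodS a n s :
  (qprod a n.+1)`_s.+1 = (qprod a n)`_s.+1 + a * q ^+ n * (qprod a n)`_s.
Proof.
rewrite {1}/qprod big_ord_recr /= -/(qprod a n) mulrDr mulr1 -scalerAr.
by rewrite coefD coefZ coefMX.
Qed.

Lemma coef_qprod a n s : (qprod a n)`_s = a ^+ s * qbin n s.
Proof.
rewrite /qbin; elim: n s => [|n IH] [|s].
- by rewrite !coef_qprod0 mulr1.
- by rewrite /qprod !big_ord0 coef1 mulr0.
- by rewrite !coef_qprod0 mulr1.
- by rewrite !coef_qprodS !IH exprS; ring.
Qed.

Lemma qbin0 n : qbin n 0 = 1. Proof. exact: coef_qprod0. Qed.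

Lemma qbinS n s : qbin n.+1 s.+1 = qbin n s.+1 + q ^+ n * qbin n s.
Proof. by rewrite /qbin coef_qprodS mul1r. Qed.

Lemma qbin_small n s : (n < s)%N -> qbin n s = 0.
Proof.
elim: n s => [|n IH] [|s] // ns; first by rewrite /qbin /qprod big_ord0 coef1.
by rewrite qbinS !IH ?mulr0 ?addr0 // ltnW.
Qed.

Lemma qbinnn n : qbin n n = q ^+ 'C(n, 2).
Proof.
elim: n => [|n IH]; first by rewrite qbin0.
by rewrite qbinS qbin_small // add0r IH -exprD binS bin1 addnC.
Qed.

(** The first n factors of [qprod 1 (n + N)] form [qprod 1 n], the other N form
    [qprod (q ^+ n) N]. *)
Lemma qbin_conv N n m :
  qbin (n + N) m = \sum_(s < m.+1) qbin n s * (q ^+ (n * (m - s)) * qbin N (m - s)).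
Proof.
rewrite {1}/qbin {1}/qprod big_split_ord /= -/(qprod 1 n).
rewrite [X in _ * X](_ : _ = qprod (q ^+ n) N); last first.
  by rewrite /qprod; apply: eq_bigr => i _; rewrite mul1r exprD.
by rewrite coefM; apply: eq_bigr => s _; rewrite (coef_qprod (q ^+ n)) exprM.
Qed.

(** Splitting off N factors first moves the power of q to the other index. *)
Lemma qbin_convr N n m :
  qbin (n + N) m = \sum_(s < m.+1) q ^+ (N * s) * qbin n s * qbin N (m - s).
Proof.
rewrite addnC qbin_conv (reindex_inj rev_ord_inj) /=.
apply: eq_bigr => s _; rewrite subSS subKn ?leq_ord //; ring.
Qed.

Lemma size_qroots a n : size (qroots a n) = n.+1.
Proof. by rewrite size_prod_XsubC /index_enum -enumT size_enum_ord. Qed.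

Lemma qroots_lead a n : (qroots a n)`_n = 1.
Proof.
have /monicP := monic_prod_XsubC (index_enum 'I_n) xpredT (fun l : 'I_n => a * q ^+ l).
by rewrite /lead_coef size_qroots.
Qed.

(** [qroots a n] is the reversal of the polynomial [qprod (- a) n]. *)
Lemma coef_qroots a n s :
  (s <= n)%N -> (qroots a n)`_(n - s) = (- a) ^+ s * qbin n s.
Proof.
elim: n s => [|n IH] [|s] // ns.
- by rewrite subn0 qroots_lead qbin0 mulr1.
- by rewrite subn0 qroots_lead qbin0 mulr1.
rewrite {1}/qroots big_ord_recr /= -/(qroots a n) mulrBr coefB coefMX coefMC subSS.
rewrite (IH s) // qbinS; have [sn|->] : (s < n)%N \/ s = n by lia.
  rewrite subn_eq0 leqNgt sn /= (_ : (n - s).-1 = n - s.+1)%N; last by lia.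
  by rewrite IH // exprS; ring.
by rewrite subnn eqxx (qbin_small (ltnSn n)) exprS; ring.
Qed.

Lemma horner_qroots a n x :
  (qroots a n).[x] = \prod_(l < n) (x - a * q ^+ l).
Proof. by rewrite horner_prod; apply: eq_bigr => l _; rewrite hornerXsubC. Qed.

Lemma horner_qroots_sum a n m x : (n <= m)%N ->
  (qroots a n).[x] = \sum_(j < m.+1) (qroots a n)`_j * x ^+ j.
Proof. by move=> nm; apply: horner_coef_wide; rewrite size_qroots. Qed.

Notation poch := (qpoch q q).
Notation iq z := ((qpoch q q z)^-1).

Hypothesis q_neq0 : q != 0.
Hypothesis q_aperiodic : forall j, (0 < j)%N -> q ^+ j != 1.

Lemma qpochS (m : nat) : poch m.+1%:Z = poch m%:Z * (1 - q ^+ m.+1).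
Proof.
rewrite /qpoch /= !big_mkord big_ord_recr /= -exprS //.
Qed.

Lemma qpoch0 : poch 0 = 1.
Proof. by rewrite /qpoch /= big_mkord big_ord0. Qed.

Lemma qpoch_neq0 (m : nat) : poch m%:Z != 0.
Proof.
elim: m => [|m IH]; first by rewrite qpoch0 oner_eq0.
by rewrite qpochS mulf_neq0 // subr_eq0 eq_sym q_aperiodic.
Qed.

Lemma iq_neg (z : int) : z < 0 -> iq z = 0.
Proof. by case: z => // m _; rewrite invr_qpoch_qq_neg. Qed.

(** Valid for every integer z: at z = 0 the factor 1 - q^0 matches the convention 1/(q;q)_(-1) =
    0. *)
Lemma iq_pred (z : int) : iq (z - 1) = (1 - q ^ z) * iq z.
Proof.
case: (ltrgtP z 0) => [z0|z0|->].
- by rewrite !iq_neg ?mulr0 //; lia.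
- case: z z0 => // -[|m] // _.
  rewrite (_ : Posz m.+1 - 1 = m); last by lia.
  rewrite qpochS invfM mulrCA -exprnP divff ?mulr1 //.
  by rewrite subr_eq0 eq_sym q_aperiodic.
- by rewrite expr0z subrr mul0r iq_neg.
Qed.

Lemma iq_sub (z : int) (n : nat) :
  iq (z - n%:Z) = \prod_(l < n) (1 - q ^ (z - l%:Z)) * iq z.
Proof.
elim: n => [|n IH]; first by rewrite big_ord0 mul1r subr0.
rewrite (_ : z - n.+1%:Z = z - n%:Z - 1); last by lia.
by rewrite iq_pred IH big_ord_recr /= mulrCA mulrA.
Qed.

(** By the Pascal rule [qbinS], with all reciprocals reduced to those of index m + 1 and N - m. For
    m > N both sides are 0. *)
Lemma qbinE (N m : nat) :
  qbin N m = q ^+ 'C(m, 2) * (poch N%:Z * (iq m%:Z * iq (N%:Z - m%:Z))).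
Proof.
elim: N m => [|N IH] [|m].
- by rewrite qbin0 !qpoch0 invr1 !mulr1.
- by rewrite qbin_small // (iq_neg (z := 0%:Z - m.+1%:Z)) ?mulr0.
- by rewrite qbin0 subr0 qpoch0 invr1 mul1r mul1r mulfV ?qpoch_neq0.
rewrite qbinS !IH (qpochS N) binS bin1 exprD.
rewrite (_ : N%:Z - m.+1%:Z = N%:Z - m%:Z - 1); last by lia.
rewrite (_ : N.+1%:Z - m.+1%:Z = N%:Z - m%:Z); last by lia.
rewrite iq_pred.
rewrite (_ : iq m%:Z = (1 - q ^+ m.+1) * iq m.+1%:Z); last first.
  by rewrite exprnP -iq_pred; congr (iq _); lia.
rewrite (_ : q ^+ N.+1 = q ^+ m.+1 * q ^ (N%:Z - m%:Z)); last first.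
  by rewrite !exprnP -expfzDr //; congr (_ ^ _); lia.
rewrite (_ : q ^+ N = q ^+ m * q ^ (N%:Z - m%:Z)); last first.
  by rewrite !exprnP -expfzDr //; congr (_ ^ _); lia.
rewrite exprS; ring.
Qed.

End QBinomialProduct.

(** * Vandermonde determinants whose rows are sums of geometric progressions *)

Lemma prod_exp_ord (R : comNzRingType) (x : R) (n : nat) :
  \prod_(i < n) x ^+ i = x ^+ 'C(n, 2).
Proof. by rewrite prodrXr -bin2_sum big_mkord. Qed.

Lemma prodrMl_ord (R : comNzRingType) (x : R) (n : nat) (F : 'I_n -> R) :
  x ^+ n * \prod_(i < n) F i = \prod_(i < n) (x * F i).
Proof. by rewrite big_split /= prodr_const card_ord. Qed.

(** By multilinearity in the rows, row i picks one term k = f i; each choice f leaves a Vandermonde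
    determinant with nodes x_i(f i), times the monomial of degree sum_i f i. *)
Lemma coef_det_generalized_Vandermonde (R : comNzRingType) (n B : nat)
    (a x : 'I_n -> 'I_B -> R) (m : nat) :
  (\det (\matrix_(i < n, j < n) \sum_(k < B) (a i k * x i k ^+ j) *: 'X^k))`_m
  = \sum_(f : {ffun 'I_n -> 'I_B} | (\sum_i f i == m)%N)
      (\prod_i a i (f i))
      * \prod_(i < n) \prod_(j < n | (i < j)%N) (x j (f j) - x i (f i)).
Proof.
rewrite /determinant coef_sum.
transitivity (\sum_(s : 'S_n) \sum_(f : {ffun 'I_n -> 'I_B} | (\sum_i f i == m)%N)
   (-1) ^+ s * ((\prod_i a i (f i)) * \prod_i x i (f i) ^+ (s i))).
  apply: eq_bigr => s _.
  under eq_bigr do rewrite mxE.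
  rewrite bigA_distr_bigA /= mulr_sumr coef_sum [RHS]big_mkcond.
  apply: eq_bigr => f _.
  rewrite scaler_prod prodrXr -scalerAr coefZ (_ : (-1) ^+ s = ((-1) ^+ s)%:P); last first.
    by rewrite rmorphXn rmorphN1.
  rewrite coefCM coefXn big_split /= eq_sym.
  by case: eqP => _; rewrite ?mulr1 ?mulr0 // mulrC.
rewrite exchange_big; apply: eq_bigr => f _ /=.
transitivity ((\prod_i a i (f i)) * \det (Vandermonde n (\row_i x i (f i)))^T).
  rewrite /determinant mulr_sumr; apply: eq_bigr => s _.
  rewrite mulrCA; congr (_ * (_ * _)).
  by apply: eq_bigr => i _; rewrite !mxE.
rewrite det_tr det_Vandermonde; congr (_ * _).
by apply: eq_bigr => i _; apply: eq_bigr => j _; rewrite !mxE.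
Qed.

(** * The q-difference equation of the sections and the recursion of their minors *)

Section SectionedDeterminant.
Variables (K : fieldType) (q : K) (p N : nat).
Hypothesis q_neq0 : q != 0.
Hypothesis q_aperiodic : forall j, (0 < j)%N -> q ^+ j != 1.

Notation n := p.+1.
Notation C := 'C(p.+1, 2).
Notation iq z := ((qpoch q q z)^-1).
Notation b := (qbin q n).

(* The weight w(a) at a = n k + i; the sign makes the total sign of a summand
   depend on the sum of the k_i only. *)
Definition sect_wt (i k : nat) : K :=
  (-1) ^+ (p * k) * q ^+ (n.+1 * (n * 'C(k, 2) + i * k))
  * (iq (n * k + i)%:Z * iq (N%:Z + p%:Z - (n * k + i)%:Z)).

(** Raising k by 1 shifts A = n k + i by n, so each reciprocal q-factorial changes by n factors,
    collected in a [qroots] at q^(A + n) or at q^A. The index i enters only through these nodes,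
    hence all sections obey one equation. *)
Lemma sect_wt_rec i k :
  sect_wt i k.+1 * (qroots q 1 n).[q ^+ (n * k.+1 + i)]
  = - q ^+ C * (sect_wt i k * ('X * qroots q (q ^+ N) n).[q ^+ (n * k + i)]).
Proof.
set A := (n * k + i)%N; have -> : (n * k.+1 + i = A + n)%N by rewrite /A; lia.
rewrite hornerM hornerX !horner_qroots.
have -> : \prod_(l < n) (q ^+ (A + n) - 1 * q ^+ l)
    = (-1) ^+ n * q ^+ C * \prod_(l < n) (1 - q ^ ((A + n)%:Z - l%:Z)).
  rewrite -prod_exp_ord -mulrA -big_split /= prodrMl_ord.
  apply: eq_bigr => l _.
  rewrite (_ : q ^+ (A + n) = q ^+ l * q ^ ((A + n)%:Z - l%:Z)).
    by rewrite /=; ring.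
  by rewrite !exprnP -expfzDr //; congr (_ ^ _); lia.
have -> : \prod_(l < n) (q ^+ A - q ^+ N * q ^+ l)
    = q ^+ (n * A) * \prod_(l < n) (1 - q ^ (N%:Z + p%:Z - A%:Z - l%:Z)).
  rewrite mulnC exprM prodrMl_ord.
  rewrite (reindex_inj rev_ord_inj) /=.
  apply: eq_bigr => l _; rewrite mulrBr mulr1; congr (_ - _).
  rewrite -exprD !exprnP -expfzDr //; congr (_ ^ _).
  by have := ltn_ord l; lia.
rewrite /sect_wt -/A (_ : (n * k.+1 + i = A + n)%N); last by rewrite /A; lia.
rewrite (_ : N%:Z + p%:Z - (A + n)%:Z = N%:Z + p%:Z - A%:Z - n%:Z); last by lia.
have -> : iq A%:Z = \prod_(l < n) (1 - q ^ ((A + n)%:Z - l%:Z)) * iq (A + n)%:Z.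
  by rewrite -iq_sub //; congr (iq _); lia.
rewrite iq_sub // mulnS (exprD _ p).
(* The exponent grows by (n + 1) A: A is the value of the factor 'X at q^A, and n A comes from the
   second product. *)
have -> : (n.+1 * (n * 'C(k.+1, 2) + i * k.+1)
         = n.+1 * (n * 'C(k, 2) + i * k) + A + n * A)%N.
  by rewrite binS bin1 /A; lia.
set e := (n.+1 * (n * 'C(k, 2) + i * k))%N.
rewrite (exprD _ (e + A)%N) (exprD _ e) (exprS _ p); clearbody e.
have sq : (-1) ^+ p * (-1) ^+ p = 1 :> K by rewrite -exprD -signr_odd oddD addbb.
transitivity (- (q ^+ C * ((-1) ^+ p * (-1) ^+ p) *
  ((-1) ^+ (p * k) * (q ^+ e * q ^+ A * q ^+ (n * A)) *
   (iq (A + n)%:Z *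
    (\prod_(i0 < n) (1 - q ^ (N%:Z + p%:Z - A%:Z - i0%:Z)) * iq (N%:Z + p%:Z - A%:Z))) *
  \prod_(i0 < n) (1 - q ^ ((A + n)%:Z - i0%:Z))))).
  ring.
rewrite sq; ring.
Qed.

(** Here n k + i > N + p, so the second reciprocal has a negative index. Hence the sections are
    polynomials of degree at most N. *)
Lemma sect_wt_big i k : (N < k)%N -> sect_wt i k = 0.
Proof.
move=> Nk; rewrite /sect_wt [X in _ * (_ * X)](iq_neg q_neq0) ?mulr0 //.
by move: Nk; nia.
Qed.

(** The i-th section at q^t u, divided by u^i, as a polynomial in 'X = u^n. *)
Definition sect (t : nat) (i : 'I_n) : {poly K} :=
  \sum_(k < N.+1) (sect_wt i k * (q ^+ (n * k + i)) ^+ t) *: 'X^k.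

Lemma coef_sect t i k : (sect t i)`_k = sect_wt i k * (q ^+ (n * k + i)) ^+ t.
Proof.
rewrite /sect -(poly_def N.+1 (fun k => sect_wt i k * (q ^+ (n * k + i)) ^+ t)).
by rewrite coef_poly ltnS leqNgt; case: ltnP => //= Nk; rewrite sect_wt_big ?mul0r.
Qed.

(* The coefficient of q^j-dilation in the q-difference equation of the sections,
   taken at q^t u. *)
Definition sect_coef (t j : nat) : {poly K} :=
  ((qroots q 1 n)`_j)%:P
  + (q ^+ (C + n * t) * ('X * qroots q (q ^+ N) n)`_j) *: 'X.

(** In the coefficient of 'X^k the sum over l evaluates [qroots q 1 n] at x = q^(n k + i) and the
    other polynomial at y = x / q^n; [sect_wt_rec] cancels the two. *)
Lemma sect_rel t i : \sum_(l < p.+3) sect_coef t l * sect (t + l) i = 0.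
Proof.
have hX x : ('X * qroots q (q ^+ N) n).[x] =
    \sum_(l < p.+3) ('X * qroots q (q ^+ N) n)`_l * x ^+ l.
  apply: horner_coef_wide; rewrite mulrC size_mulX ?size_qroots //.
  by rewrite -size_poly_eq0 size_qroots.
apply/polyP => k; rewrite coef0 coef_sum.
pose x := q ^+ (n * k + i).
transitivity (sect_wt i k * x ^+ t * (qroots q 1 n).[x]
   + (if k is k'.+1 then let y := q ^+ (n * k' + i) in
     q ^+ (C + n * t) * (sect_wt i k' * y ^+ t * ('X * qroots q (q ^+ N) n).[y]) else 0)).
  rewrite (@horner_qroots_sum _ _ _ _ p.+2) // mulr_sumr.
  case: k @x => [|k] x.
    rewrite addr0; apply: eq_bigr => l _.
    rewrite /sect_coef mulrDl coefD coefCM -scalerAl coefZ (coefXM (sect _ _)) /= mulr0 addr0.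
    by rewrite coef_sect -/x exprD; ring.
  rewrite /= hX !mulr_sumr -big_split; apply: eq_bigr => l _ /=.
  rewrite /sect_coef mulrDl coefD coefCM -scalerAl coefZ (coefXM (sect _ _)) /=.
  by rewrite !coef_sect -/x !exprD; ring.
case: k @x => [|k] x.
  (* For k = 0 there is no second term, and x = q^i with i < n is a root. *)
  rewrite horner_qroots (bigD1 i) //= /x muln0 add0n mul1r subrr.
  by rewrite mul0r mulr0 addr0.
rewrite /= mulrAC sect_wt_rec /x.
have -> : (n * k.+1 + i = n * k + i + n)%N by lia.
move: (n * k + i)%N => a; move: (_.[_]) => h.
by rewrite (exprD _ a n) (exprD _ C) exprMn (exprM _ n); ring.
Qed.

Notation E := (omit_det sect).
Notation D t := (omit_det sect t n).

(** The case j = p - s of [omit_det_rec], solved for the minor at t; counting from the top makes the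
    coefficients [qbin] at s and s + 1. *)
Lemma omit_det_sect_rec t s : (s <= p)%N ->
  q ^+ C *: E t (n - s) =
  b s *: D t.+1 - (q ^+ (C + n * t) * q ^+ (N * s.+1) * b s.+1) *: ('X * D t.+1)
  + q ^+ (C + n * t) *: ('X * E t.+1 (p - s)).
Proof.
move=> sp.
have := omit_det_rec (leq_subr s p) (sect_rel t).
rewrite -subSn //.
have -> : sect_coef t 0 = ((-1) ^+ n * q ^+ C)%:P.
  rewrite /sect_coef coefXM /= mulr0 scale0r addr0.
  by have := coef_qroots q 1 (leqnn n); rewrite subnn qbinnn => ->.
have -> : sect_coef t p.+2 = q ^+ (C + n * t) *: 'X.
  rewrite /sect_coef coefXM /= qroots_lead mulr1.
  by rewrite nth_default ?polyC0 ?add0r // size_qroots.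
have -> : sect_coef t (n - s) =
    ((-1) ^+ s * b s)%:P
    - ((-1) ^+ s * q ^+ (C + n * t) * q ^+ (N * s.+1) * b s.+1) *: 'X.
  rewrite /sect_coef coefXM (_ : (n - s == 0)%N = false); last by lia.
  rewrite coef_qroots ?(leqW sp) // (_ : (n - s).-1 = n - s.+1)%N; last by lia.
  rewrite coef_qroots ?ltnS // exprM -[RHS]addrC [LHS]addrC; congr (_ + _).
  by rewrite -scaleNr; congr (_ *: _); rewrite (exprNn (q ^+ N)) (exprS _ s); ring.
have sq k : (-1) ^+ k * (-1) ^+ k = 1 :> {poly K}.
  by rewrite -exprD -signr_odd oddD addbb.
have sps : (-1) ^+ (p - s) = (-1) ^+ p * (-1) ^+ s :> {poly K}.
  by rewrite -{2}(subnK sp) exprD -mulrA sq mulr1.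
rewrite sps -!mul_polyC !polyCM !polyC_exp !polyCN polyC1 => rel.
have -> : q%:P ^+ C * E t (n - s) =
  - ((-1) ^+ p * ((-1) ^+ n * q%:P ^+ C * E t (n - s))).
  transitivity ((-1) ^+ p * (-1) ^+ p * (q%:P ^+ C * E t (n - s))).
    by rewrite sq mul1r.
  by rewrite (exprS _ p); ring.
move/(congr1 (fun x => (-1) ^+ p * x)): rel.
rewrite mulr0 !mulrDr -!addrA => /eqP; rewrite addr_eq0 => /eqP ->.
rewrite opprK; set X1 := (-1) ^+ p; set X2 := (-1) ^+ s.
transitivity (X1 * X1 * (X2 * X2 * ((b s)%:P * D t.+1
     - q%:P ^+ (C + n * t) * q%:P ^+ (N * s.+1) * (b s.+1)%:P * 'X * D t.+1)) +
   X1 * X1 * (q%:P ^+ (C + n * t) * ('X * E t.+1 (p - s)))); first by ring.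
rewrite !sq; ring.
Qed.

End SectionedDeterminant.

(** * The coefficients of the determinant of the sections *)

Lemma sum_ord_trunc (V : nmodType) (a M : nat) (f : nat -> V) :
  (forall s, (a <= s)%N -> f s = 0) ->
  \sum_(s < a) (if (s < M)%N then f s else 0) = \sum_(s < M) f s.
Proof.
move=> f0; rewrite (big_ord_widen (a + M) (fun s => if (s < M)%N then f s else 0)) ?leq_addr //.
rewrite [RHS](big_ord_widen (a + M)) ?leq_addl // big_mkcond [RHS]big_mkcond.
apply: eq_bigr => s _; case: (ltnP s a) => // sa.
by case: ifP => // _; rewrite f0.
Qed.

Lemma bin2D a c : 'C(a + c, 2) = ('C(a, 2) + 'C(c, 2) + a * c)%N.
Proof.
by elim: a => [|a IH]; [rewrite add0n bin0n; lia | rewrite addSn !binS !bin1 IH; lia].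
Qed.

Section DeterminantCoefficients.
Variables (K : fieldType) (q : K) (p N : nat).
Hypothesis q_neq0 : q != 0.
Hypothesis q_aperiodic : forall j, (0 < j)%N -> q ^+ j != 1.

Notation n := p.+1.
Notation C := 'C(p.+1, 2).
Notation b := (qbin q n).
Notation E := (omit_det (@sect K q p N)).
Notation D t := (omit_det (@sect K q p N) t n).

Lemma omit_det_chain k : (k <= n)%N ->
  D 0 = \sum_(s < k) q ^+ (n * 'C(s, 2)) *: ('X^s *
          (((q ^+ C)^-1 * b s) *: D s.+1
           - (q ^+ (n * s) * q ^+ (N * s.+1) * b s.+1) *: ('X * D s.+1)))
        + q ^+ (n * 'C(k, 2)) *: ('X^k * E k (n - k)).
Proof.
elim: k => [|k IH] kn.
  by rewrite big_ord0 add0r subn0 bin0n muln0 scale1r mul1r.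
rewrite (IH (ltnW kn)) big_ord_recr /= -addrA; congr (_ + _).
have qC0 : q ^+ C != 0 by rewrite expf_neq0.
have -> : E k (n - k) = (q ^+ C)^-1 *: (q ^+ C *: E k (n - k)).
  by rewrite scalerA mulVf ?scale1r.
rewrite omit_det_sect_rec // subSS.
have -> : q ^+ (n * 'C(k.+1, 2)) = q ^+ (n * 'C(k, 2)) * q ^+ (n * k).
  by rewrite -exprD -mulnDr (binS k) bin1.
have -> : q ^+ (n * k) = (q ^+ C)^-1 * q ^+ (C + n * k).
  by rewrite exprD mulKf.
by rewrite exprSr -!mul_polyC !polyCM; ring.
Qed.

Lemma coef_omit_det t m :
  (D t)`_m = \sum_(f : {ffun 'I_n -> 'I_N.+1} | (\sum_i f i == m)%N)
      (\prod_(i < n) (sect_wt q p N i (f i) * (q ^+ (n * f i + i)) ^+ t))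
      * \prod_(i < n) \prod_(j < n | (i < j)%N)
          (q ^+ (n * f j + j) - q ^+ (n * f i + i)).
Proof.
pose a (i : 'I_n) (k : 'I_N.+1) := sect_wt q p N i k * (q ^+ (n * k + i)) ^+ t.
pose x (i : 'I_n) (k : 'I_N.+1) := q ^+ (n * k + i).
rewrite -[RHS](coef_det_generalized_Vandermonde a x).
congr ((polyseq (\det _))`_m); apply/matrixP => i j; rewrite !mxE /bump leqNgt ltn_ord add0n.
by apply: eq_bigr => k _; rewrite exprD mulrA.
Qed.

(** Only the powers (q^(n f_i + i))^t depend on t, and the exponents n f_i + i sum to n m + C. *)
Lemma coef_omit_det_shift t m : (D t)`_m = q ^+ (t * (n * m + C)) * (D 0)`_m.
Proof.
rewrite !coef_omit_det mulr_sumr; apply: eq_bigr => f /eqP fm.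
rewrite mulrA; congr (_ * _).
under [X in _ = _ * X]eq_bigr do rewrite expr0 mulr1.
rewrite big_split /= mulrC; congr (_ * _).
under eq_bigr do rewrite -exprM mulnC.
rewrite prodrXr; congr (_ ^+ _); rewrite -big_distrr big_split /=.
by rewrite -big_distrr /= fm -bin2_sum big_mkord.
Qed.

(** Taking coefficients in [omit_det_chain] at k = n gives a scalar recurrence for the coefficients
    [d]. The claimed values [r] satisfy it as well, and it has one solution with given [d 0]: the
    unknown [d k] occurs on both sides, with total coefficient 1 - q^(n k), nonzero for k > 0. *)
Lemma coef_omit_det0 m :
  (D 0)`_m = q ^+ (n * 'C(m, 2) + C * m) * qbin q N m * (D 0)`_0.
Proof.
pose d m := (D 0)`_m.
pose r m := q ^+ (n * 'C(m, 2) + C * m) * qbin q N m * d 0%N.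
pose F m s := q ^+ (n * 'C(s, 2)) * b s * q ^+ (s.+1 * (n * (m - s)) + s * C).
pose G m s := q ^+ (n * 'C(s, 2)) * (q ^+ (n * s) * q ^+ (N * s.+1) * b s.+1)
  * q ^+ (s.+1 * (n * (m - s.+1) + C)).
have qC0 : q ^+ C != 0 by rewrite expf_neq0.
have drec k : d k = \sum_(s < k.+1) F k s * d (k - s)%N
                    - \sum_(s < k) G k s * d (k - s.+1)%N.
  rewrite -(@sum_ord_trunc _ n.+1 k.+1 (fun s => F k s * d (k - s)%N)); last first.
    by move=> s ns; rewrite /F qbin_small ?mulr0 ?mul0r.
  rewrite -(@sum_ord_trunc _ n k (fun s => G k s * d (k - s.+1)%N)); last first.
    by move=> s ns; rewrite /G qbin_small ?mulr0 ?mul0r ?ltnS.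
  rewrite /d {1}(omit_det_chain (leqnn n)) subnn.
  (* Omitting the first column only shifts the window; this remainder becomes the term s = n of the
     first sum. *)
  have -> : E n 0 = D n.+1.
    congr (\det _); apply/matrixP => i c; rewrite !mxE; congr sect.
    by rewrite /bump leq0n [(n <= c)%N]leqNgt ltn_ord; lia.
  rewrite coefD coef_sum [X in _ = X - _]big_ord_recr /= addrAC -sumrB; congr (_ + _).
    apply: eq_bigr => s _.
    rewrite coefZ mulrBr -!scalerAr mulrA -exprSr coefB !coefZ !coefXnM ltnS.
    rewrite mulrBr; congr (_ - _).
      rewrite leqNgt; case: ltnP => _ /=; rewrite ?mulr0 //.
      rewrite coef_omit_det_shift /F mulnDr [(s.+1 * C)%N]mulSn addnCA.
      by rewrite (exprD _ C); field.
    rewrite leqNgt; case: ltnP => _ /=; rewrite ?mulr0 //.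
    by rewrite coef_omit_det_shift /G; ring.
  rewrite coefZ coefXnM [(n < k.+1)%N]ltnS [(n <= k)%N]leqNgt.
  case: ltnP => _ /=; rewrite ?mulr0 //.
  rewrite coef_omit_det_shift /F qbinnn mulnDr [(n.+1 * C)%N]mulSn addnCA.
  by rewrite (exprD _ C) !mulrA.
have rrec k : r k = \sum_(s < k.+1) F k s * r (k - s)%N
                    - \sum_(s < k) G k s * r (k - s.+1)%N.
  have -> : \sum_(s < k.+1) F k s * r (k - s)%N
      = q ^+ (n * 'C(k, 2) + C * k) * qbin q (n + N) k * d 0%N.
    rewrite qbin_conv mulr_sumr mulr_suml; apply: eq_bigr => -[s /= sk] _.
    have [j ->] : exists j, k = (s + j)%N by exists (k - s)%N; lia.
    rewrite /F /r addKn bin2D.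
    have -> : q ^+ (n * ('C(s, 2) + 'C(j, 2) + s * j) + C * (s + j)) *
       (b s * (q ^+ (n * j) * qbin q N j)) * d 0%N =
       q ^+ (n * ('C(s, 2) + 'C(j, 2) + s * j) + C * (s + j) + n * j)
        * b s * qbin q N j * d 0%N by rewrite (exprD _ _ (n * j)); ring.
    rewrite (_ : (_ + C * (s + j) + n * j = n * 'C(s, 2) + (s.+1 * (n * j) + s * C)
      + (n * 'C(j, 2) + C * j))%N); last by lia.
    move: (n * 'C(s, 2))%N (s.+1 * (n * j) + s * C)%N (n * 'C(j, 2) + C * j)%N => e1 e2 e3.
    by rewrite (exprD _ (e1 + e2)%N) (exprD _ e1); ring.
  (* This is [qbin_convr] without its term s = 0, so subtracting it from the first sum leaves
     [r k]. *)
  have -> : \sum_(s < k) G k s * r (k - s.+1)%N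
      = q ^+ (n * 'C(k, 2) + C * k) * (qbin q (n + N) k - qbin q N k) * d 0%N.
    rewrite qbin_convr big_ord_recl /= muln0 qbin0 subn0 mulr1 mul1r addrAC subrr add0r.
    rewrite mulr_sumr mulr_suml; apply: eq_bigr => -[s /= sk] _.
    have [j ->] : exists j, k = (s.+1 + j)%N by exists (k - s.+1)%N; lia.
    rewrite /G /r /bump /= add1n addKn bin2D.
    rewrite (_ : (n * ('C(s.+1, 2) + 'C(j, 2) + s.+1 * j) + C * (s.+1 + j)
       = n * 'C(s, 2) + n * s + s.+1 * (n * j + C) + (n * 'C(j, 2) + C * j))%N).
      move: (n * 'C(s, 2))%N (n * s)%N (s.+1 * (n * j + C))%N (n * 'C(j, 2) + C * j)%N.
      move=> e1 e2 e3 e4.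
      by rewrite (exprD _ (e1 + e2 + e3)%N) (exprD _ (e1 + e2)%N) (exprD _ e1); ring.
    by rewrite (binS s) bin1; lia.
  by rewrite /r; ring.
suff : d m = r m by [].
elim/ltn_ind: m => -[|m] IH.
  by rewrite /r bin0n !muln0 addn0 qbin0 !mul1r.
have : d m.+1 - r m.+1 = F m.+1 0%N * (d m.+1 - r m.+1).
  rewrite {1}drec {1}rrec !big_ord_recl /= !subn0.
  set S1 := \sum_(_ < _) _; set S2 := \sum_(_ < _) _.
  set S3 := \sum_(_ < _) _; set S4 := \sum_(_ < _) _.
  have -> : S1 = S3.
    by apply: eq_bigr => s _; rewrite IH // ?/bump ?leq0n ?add1n subSS ltnS leq_subr.
  have -> : S2 = S4.
    by apply: eq_bigr => s _; rewrite IH // ?/bump ?leq0n ?add1n subSS ltnS leq_subr.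
  have -> : d (m.+1 - 1)%N = r (m.+1 - 1)%N by apply: IH; lia.
  by ring.
rewrite /F qbin0 bin0n muln0 !mul1r subn0 mul0n addn0 mul1n => /eqP.
rewrite -subr_eq0 -[X in X - _]mul1r -mulrBl mulf_eq0 !subr_eq0 eq_sym.
by rewrite (negPf (q_aperiodic _)) //= => /eqP.
Qed.

End DeterminantCoefficients.

(** * The summand and its behaviour under cyclic relabelling *)

Lemma mul2_bin2 m : (2 * 'C(m.+1, 2) = m.+1 * m)%N.
Proof. by elim: m => [|m IH] //; rewrite binS mulnDr IH bin1; lia. Qed.

Lemma sum_succ_ord m : \sum_(i < m) i.+1%:Z = 'C(m.+1, 2)%:Z.
Proof.
elim: m => [|m IH]; first by rewrite big_ord0.
by rewrite big_ord_recr /= IH (binS m.+1) bin1; lia.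
Qed.

Lemma prodr_const_gt (R : comNzRingType) (x : R) (n i : nat) :
  \prod_(j < n | (i < j)%N) x = x ^+ (n - i.+1).
Proof.
rewrite -prodr_const_nat big_geq_mkord; apply: eq_bigl => j.
by rewrite andTb.
Qed.

Lemma exprz_sum (K : fieldType) (x : K) (I : finType) (F : I -> int) :
  x != 0 -> x ^ (\sum_i F i) = \prod_i x ^ F i.
Proof.
move=> x0; apply: (big_morph (fun z => x ^ z)) => [a b|]; last exact: expr0z.
exact: expfzDr.
Qed.

Section Summand.
Variables (K : fieldType) (q : K) (p : nat).
Hypothesis q_neq0 : q != 0.
Hypothesis q_aperiodic : forall j, (0 < j)%N -> q ^+ j != 1.

Notation n := p.+1.
Notation iq z := ((qpoch q q z)^-1).
Implicit Types k : {ffun 'I_n -> int}.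

Definition cyc_exp k : int :=
  'C(n.+1, 2)%:Z * (\sum_(i < n) k i ^+ 2) + \sum_(i < n) i.+1%:Z * k i.

Definition cyc_vdm k : K :=
  \prod_(i < n) \prod_(j < n | (i < j)%N)
    (1 - q ^ (n%:Z * k j - n%:Z * k i + j.+1%:Z - i.+1%:Z)).

Definition cyc_quot (M1 M2 : nat) k : K :=
  \prod_(i < n) (qpoch q q (M1%:Z + M2%:Z + i.+1%:Z - 1)
    / (qpoch q q (M1%:Z + n%:Z * k i + i.+1%:Z - 1)
       * qpoch q q (M2%:Z - n%:Z * k i + n%:Z - i.+1%:Z))).

Definition cyc_term (M1 M2 : nat) (S : int) k : K :=
  (-1) ^ ((n%:Z - 1) * S) * q ^ cyc_exp k * cyc_vdm k * cyc_quot M1 M2 k.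

Definition cyc_rot k : {ffun 'I_n -> int} :=
  [ffun i => if unlift ord0 i is Some j then k (widen_ord (leqnSn p) j)
             else k ord_max + 1].

Lemma cyc_rot0 k : cyc_rot k ord0 = k ord_max + 1.
Proof. by rewrite ffunE unlift_none. Qed.

Lemma cyc_rotS k j : cyc_rot k (lift ord0 j) = k (widen_ord (leqnSn p) j).
Proof. by rewrite ffunE liftK. Qed.

Lemma cyc_rot_inj : injective cyc_rot.
Proof.
move=> k k' e; apply/ffunP => i.
have [j|] := unliftP ord_max i => ->.
  have -> : lift ord_max j = widen_ord (leqnSn p) j.
    by apply: val_inj; rewrite /= /bump leqNgt ltn_ord.
  by rewrite -!cyc_rotS e.
by have := cyc_rot0 k; rewrite e cyc_rot0 => /addIr.
Qed.

Lemma cyc_rot_surj k' : exists k, cyc_rot k = k'.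
Proof.
exists [ffun i => if unlift ord_max i is Some j then k' (lift ord0 j)
                  else k' ord0 - 1].
apply/ffunP => i; have [j|] := unliftP ord0 i => ->.
  rewrite cyc_rotS ffunE (_ : widen_ord _ _ = lift ord_max j) ?liftK //.
  by apply: val_inj; rewrite /= /bump leqNgt ltn_ord.
by rewrite cyc_rot0 ffunE unlift_none subrK.
Qed.

Lemma cyc_rot_sum k : \sum_i cyc_rot k i = \sum_i k i + 1.
Proof.
rewrite big_ord_recl cyc_rot0 [in RHS]big_ord_recr /=.
by under eq_bigr do rewrite cyc_rotS; ring.
Qed.

(** With i from 1, the denominators see k_i only through n k_i + i, which the relabelling raises by
    1, also when k_n + 1 moves to the first place; the numerators see only M1 + M2. *)
Lemma cyc_quot_rot M1 M2 k : cyc_quot M1.+1 M2 k = cyc_quot M1 M2.+1 (cyc_rot k).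
Proof.
rewrite /cyc_quot !big_split; congr (_ * _).
  by apply: eq_bigr => i _; apply: congr1; lia.
rewrite big_ord_recr [in RHS]big_ord_recl /= mulrC cyc_rot0; congr (_ * _).
  by apply: congr1; congr (_ * _); apply: congr1; lia.
apply: eq_bigr => i _; rewrite cyc_rotS.
by apply: congr1; congr (_ * _); apply: congr1; rewrite /= /bump; lia.
Qed.

(** Pairs without the last index keep their difference. A pair with it has difference e_i, which
    changes sign, and 1 - q^(-e) = - q^(-e) (1 - q^e). *)
Lemma cyc_vdm_rot k (e := fun i : 'I_p =>
    n%:Z * k ord_max - n%:Z * k (widen_ord (leqnSn p) i) + n%:Z - i.+1%:Z) :
  cyc_vdm (cyc_rot k) = (-1) ^+ p * q ^ (- \sum_i e i) * cyc_vdm k.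
Proof.
have split_last (f : 'I_n -> 'I_n -> K) :
  \prod_(i < n) \prod_(j < n | (i < j)%N) f i j =
  (\prod_(i < p) \prod_(j < p | (i < j)%N)
     f (widen_ord (leqnSn p) i) (widen_ord (leqnSn p) j))
  * \prod_(i < p) f (widen_ord (leqnSn p) i) ord_max.
  rewrite big_ord_recr /= [X in _ * X]big1 ?mulr1 => [|j]; last first.
    by rewrite ltnNge -ltnS ltn_ord.
  rewrite -big_split; apply: eq_bigr => i _ /=.
  by rewrite big_mkcond big_ord_recr /= ltn_ord -big_mkcond.
have split_first (f : 'I_n -> 'I_n -> K) :
  \prod_(i < n) \prod_(j < n | (i < j)%N) f i j =
  (\prod_(i < p) \prod_(j < p | (i < j)%N) f (lift ord0 i) (lift ord0 j))
  * \prod_(j < p) f ord0 (lift ord0 j).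
  rewrite big_ord_recl /= mulrC; congr (_ * _).
    apply: eq_bigr => i _; rewrite big_mkcond big_ord_recl /= mul1r -big_mkcond.
    by apply: eq_bigl => j; rewrite /bump !leq0n.
  by rewrite big_mkcond big_ord_recl /= mul1r.
rewrite /cyc_vdm split_first split_last mulrCA; congr (_ * _).
  by do 2![apply: eq_bigr => ? _]; rewrite !cyc_rotS; congr (1 - q ^ _);
    rewrite /= /bump; lia.
have -> : q ^ (- \sum_i e i) = \prod_(i < p) q ^ (- e i).
  by rewrite -sumrN exprz_sum.
rewrite -mulrA -big_split prodrMl_ord; apply: eq_bigr => i _ /=.
rewrite cyc_rotS cyc_rot0.
rewrite [X in 1 - q ^ X](_ : _ = - e i); last by rewrite /e /= /bump; lia.
rewrite [X in _ * (_ * (1 - q ^ X))](_ : _ = e i); last by rewrite /e /=; lia.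
rewrite mulN1r mulrBr mulr1 -expfzDr // addNr expr0z; ring.
Qed.

(** The powers of q released by [cyc_vdm_rot] cancel the change of the quadratic form up to a term
    in the sum of the k_i alone. *)
Lemma cyc_exp_rot k (e := fun i : 'I_p =>
    n%:Z * k ord_max - n%:Z * k (widen_ord (leqnSn p) i) + n%:Z - i.+1%:Z) :
  cyc_exp (cyc_rot k) - \sum_i e i = cyc_exp k + (n%:Z + 1) * (\sum_i k i + 1).
Proof.
pose w (i : 'I_p) := widen_ord (leqnSn p) i.
have -> : \sum_i e i = p%:Z * (n%:Z * k ord_max + n%:Z)
    - n%:Z * (\sum_(i < p) k (w i)) - 'C(n, 2)%:Z.
  have sumc (c : int) : \sum_(i < p) c = p%:Z * c.
    by rewrite sumr_const card_ord -mulr_natl natz.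
  rewrite -sum_succ_ord -sumc mulr_sumr.
  by rewrite -!sumrB; apply: eq_bigr => i _; rewrite /e /w; lia.
rewrite /cyc_exp ![\sum_(i < n) cyc_rot _ _ ^+ 2]big_ord_recl.
rewrite [\sum_(i < n) _ * cyc_rot _ _]big_ord_recl.
rewrite ![\sum_(i < n) k _ ^+ 2]big_ord_recr [\sum_(i < n) _ * k _]big_ord_recr /=.
rewrite [\sum_(i < n) k _]big_ord_recr /= cyc_rot0.
have -> : \sum_(i < p) cyc_rot k (lift ord0 i) ^+ 2 = \sum_(i < p) k (w i) ^+ 2.
  by apply: eq_bigr => i _; rewrite cyc_rotS.
have -> : \sum_(i < p) (bump 0 i).+1%:Z * cyc_rot k (lift ord0 i)
    = \sum_(i < p) i.+1%:Z * k (w i) + \sum_(i < p) k (w i).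
  by rewrite -big_split; apply: eq_bigr => i _; rewrite cyc_rotS /bump /w /=; lia.
rewrite -/w.
move: (\sum_(i < p) k (w i)) (\sum_(i < p) _ * _) (\sum_(i < p) _ ^+ 2) (k _) => T L Q a.
have h1 := mul2_bin2 p; have := binS n 1; rewrite bin1 => h2.
rewrite h2 PoszD.
have {h1}: 2 * 'C(n, 2)%:Z = (p%:Z + 1) * p%:Z by lia.
move: 'C(n, 2)%:Z => c hc.
rewrite (_ : n%:Z = p%:Z + 1); last by lia.
move: p%:Z hc => P hc.
apply/eqP; rewrite -subr_eq0; apply/eqP.
(* The two sides differ by a multiple of 2 c - (P + 1) P, which is 0 for c the binomial
   coefficient. *)
transitivity ((a + 1) * (2 * c - (P + 1) * P)); last by rewrite hc subrr mulr0.
ring.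
Qed.

(** The sign (-1)^p of [cyc_vdm_rot] is absorbed by the change of (-1)^((n - 1) S). *)
Lemma cyc_term_rot M1 M2 k S : \sum_i k i = S ->
  cyc_term M1 M2.+1 (S + 1) (cyc_rot k)
  = q ^ ((n%:Z + 1) * (S + 1)) * cyc_term M1.+1 M2 S k.
Proof.
move=> <-; rewrite /cyc_term -cyc_quot_rot cyc_vdm_rot.
have := cyc_exp_rot k; set e := \sum_(i < p) _ => h.
have {}h : q ^ cyc_exp (cyc_rot k) * q ^ (- e)
    = q ^ cyc_exp k * q ^ ((n%:Z + 1) * (\sum_i k i + 1)).
  by rewrite -[LHS]expfzDr // h -expfzDr.
have -> : (-1) ^ ((n%:Z - 1) * (\sum_i k i + 1))
    = (-1) ^ ((n%:Z - 1) * \sum_i k i) * (-1) ^+ p :> K.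
  rewrite exprnP -expfzDr ?oppr_eq0 ?oner_eq0 //; congr (_ ^ _); lia.
have sq : (-1) ^+ p * (-1) ^+ p = 1 :> K by rewrite -exprD -signr_odd oddD addbb.
move: h; move: (q ^ _) (q ^ _) (q ^ _) (q ^ _) (cyc_vdm k) (cyc_quot _ _ _) ((-1) ^ _).
move=> x4 x3 x2 x1 X Y s h.
transitivity (s * ((-1) ^+ p * (-1) ^+ p) * (x1 * x2) * X * Y); first by ring.
by rewrite sq h; ring.
Qed.

Definition cyc_sum M1 M2 (S : int) : K :=
  \sum_(k \in [set k : {ffun 'I_n -> int} | \sum_(i < n) k i = S]) cyc_term M1 M2 S k.

Lemma cyc_sum_rot M1 M2 S :
  cyc_sum M1 M2.+1 (S + 1) = q ^ ((n%:Z + 1) * (S + 1)) * cyc_sum M1.+1 M2 S.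
Proof.
rewrite /cyc_sum mulr_fsumr.
rewrite (@reindex_fsbig _ _ _ _ _ cyc_rot [set k : {ffun 'I_n -> int} | \sum_(i < n) k i = S]).
  by apply: eq_fsbigr => k; rewrite inE /= => /cyc_term_rot.
split.
- by move=> k /= <-; rewrite cyc_rot_sum.
- by move=> k k' _ _; exact: cyc_rot_inj.
- move=> k' /= k'S; have [k kk'] := cyc_rot_surj k'; exists k => //=.
  by move: k'S; rewrite -kk' cyc_rot_sum => /addIr.
Qed.

End Summand.

(** * The case M1 = 0, through the determinant *)

Section ZeroLowerBound.
Variables (K : fieldType) (q : K) (p N : nat).
Hypothesis q_neq0 : q != 0.
Hypothesis q_aperiodic : forall j, (0 < j)%N -> q ^+ j != 1.

Notation n := p.+1.
Notation poch := (qpoch q q).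
Notation iq z := ((qpoch q q z)^-1).
Implicit Types f : {ffun 'I_n -> 'I_N.+1}.

Definition cyc_emb f : {ffun 'I_n -> int} := [ffun i => (f i : nat)%:Z].

Lemma cyc_emb_sum f : \sum_i cyc_emb f i = (\sum_i f i)%N%:Z.
Proof. by rewrite (big_morph Posz PoszD (erefl _)); apply: eq_bigr => i _; rewrite ffunE. Qed.

(** With m^2 = m + 2 'C(m, 2), the exponent of q not in [sect_wt] has at index i the coefficient
    'C(n + 1, 2) + (i + 1) - n (p - i) - (n + 1) i of m, which does not depend on i; hence only the
    sum of the k_i matters. *)
Let slope : int := 1 - n%:Z * p%:Z + 'C(n.+1, 2)%:Z.

Let scale : K := (\prod_(i < n) \prod_(j < n | (i < j)%N) -1)
  * \prod_(i < n) (q ^ (- ((p - i) * i)%N%:Z) * poch (N%:Z + i%:Z)).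

(** From 1 - q^(b - a) = - q^(-a) (q^b - q^a), where the index i is the smaller one in p - i
    pairs. *)
Lemma cyc_vdm_emb f :
  cyc_vdm q (cyc_emb f) = (\prod_(i < n) \prod_(j < n | (i < j)%N) -1)
   * (\prod_(i < n) q ^ (- ((p - i) * (n * f i + i))%N%:Z))
   * \prod_(i < n) \prod_(j < n | (i < j)%N)
          (q ^+ (n * f j + j) - q ^+ (n * f i + i)).
Proof.
rewrite /cyc_vdm -!big_split; apply: eq_bigr => i _ /=.
have -> : q ^ (- ((p - i) * (n * f i + i))%N%:Z)
    = \prod_(j < n | (i < j)%N) q ^ (- (n * f i + i)%N%:Z).
  rewrite prodr_const_gt subSS exprnP exprz_exp; congr (_ ^ _).
  by rewrite PoszM mulNr mulrC.
rewrite -!big_split.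
apply: eq_bigr => j _ /=; rewrite !ffunE.
set a := (n * f i + i)%N; set b := (n * f j + j)%N.
rewrite [X in 1 - q ^ X](_ : _ = b%:Z - a%:Z); last by rewrite /a /b; lia.
have e : q ^ (- a%:Z) * q ^+ a = 1 by rewrite exprnP -expfzDr // addNr expr0z.
by rewrite expfzDr // -exprnP -[in LHS]e; ring.
Qed.

Lemma cyc_quot_emb f :
  cyc_quot q 0 N (cyc_emb f) = \prod_(i < n) (poch (N%:Z + i%:Z)
    * (iq (n * f i + i)%N%:Z * iq (N%:Z + p%:Z - (n * f i + i)%N%:Z))).
Proof.
apply: eq_bigr => i _; rewrite ffunE invfM.
congr (_ * (_ * _)); first by apply: congr1; lia.
  by congr (_^-1); apply: congr1; lia.
by congr (_^-1); apply: congr1; lia.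
Qed.

Lemma cyc_term_emb f s : (\sum_i f i = s)%N ->
  cyc_term q 0 N s%:Z (cyc_emb f) = q ^ (s%:Z * slope) * scale *
    ((\prod_(i < n) sect_wt q p N i (f i))
     * \prod_(i < n) \prod_(j < n | (i < j)%N)
          (q ^+ (n * f j + j) - q ^+ (n * f i + i))).
Proof.
move=> fs; rewrite /cyc_term cyc_vdm_emb cyc_quot_emb /scale.
set U := \prod_(i < n) \prod_(j < n | _) -1.
set W := \prod_(i < n) \prod_(j < n | _) (_ - _).
have -> : (-1) ^ ((n%:Z - 1) * s%:Z) = \prod_(i < n) (-1) ^+ (p * f i) :> K.
  by rewrite prodrXr -big_distrr /= fs exprnP; congr (_ ^ _); lia.
have -> : q ^ cyc_exp (cyc_emb f)
   = \prod_(i < n) q ^ ('C(n.+1, 2)%:Z * (f i : nat)%:Z ^+ 2 + i.+1%:Z * (f i : nat)%:Z).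
  rewrite -exprz_sum // /cyc_exp; congr (_ ^ _); rewrite big_split /= mulr_sumr.
  by congr (_ + _); apply: eq_bigr => i _; rewrite ffunE.
have -> : q ^ (s%:Z * slope) = \prod_(i < n) q ^ ((f i : nat)%:Z * slope).
  rewrite -exprz_sum // -mulr_suml; congr (_ ^ (_ * _)).
  by rewrite -fs (big_morph Posz PoszD (erefl _)).
have assoc (a b c d e g h k : K) : a * b * g * h = c * d * e ->
  a * b * (U * g * W) * h = c * (U * d) * (e * W).
  by move=> E; transitivity (U * W * (a * b * g * h)); [ring | rewrite E; ring].
apply: assoc => //; rewrite -!big_split; apply: eq_bigr => i _ /=.
rewrite /sect_wt; set m := (f i : nat); set A := (n * m + i)%N.
have ip : (i <= p)%N by rewrite -ltnS.
have : q ^ ('C(n.+1, 2)%:Z * m%:Z ^+ 2 + i.+1%:Z * m%:Z) * q ^ (- ((p - i) * A)%N%:Z)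
   = q ^ (m%:Z * slope) * q ^ (- ((p - i) * i)%N%:Z) * q ^+ (n.+1 * (n * 'C(m, 2) + i * m)).
  rewrite (exprnP q) -!expfzDr //. congr (_ ^ _).
  have [r pE] : exists r, p = (i + r)%N by exists (p - i)%N; lia.
  have h1 : ('C(n.+1, 2) * (m * m) = 'C(n.+1, 2) * m + n.+1 * n * 'C(m, 2))%N.
    rewrite -mul2_bin2; case: (m) => [|m']; first by rewrite !muln0.
    by have := mul2_bin2 m'; nia.
  rewrite /slope /A (_ : (p - i = r)%N); last by lia.
  move: 'C(n.+1, 2) 'C(m, 2) h1 => c2 cm h1.
  have {}h1 : c2%:Z * (m%:Z * m%:Z) = c2%:Z * m%:Z + (n%:Z + 1) * n%:Z * cm%:Z by lia.
  rewrite !(PoszM, PoszD) expr2 h1 -[n.+1]addn1 -[i.+1]addn1 !PoszD.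
  rewrite (_ : n%:Z = i%:Z + r%:Z + 1); last by lia.
  rewrite (_ : p%:Z = i%:Z + r%:Z); last by lia.
  ring.
move: (q ^ _) (q ^ _) (q ^ _) (q ^ _) (q ^+ _) ((-1) ^+ _) => x1 x2 x3 x4 x5 sg E.
change (\prod_(0 <= j < A) (1 - q * q ^+ j)) with (poch A%:Z).
move: (iq _) (iq _) (\prod_(_ <= _ < _) _) => y1 y2 y3.
transitivity (sg * (x4 * x3) * (y3 * (y2 * y1))); first by ring.
by rewrite E; ring.
Qed.

Definition cyc_total s : K :=
  \sum_(f : {ffun 'I_n -> 'I_N.+1} | (\sum_i f i == s)%N) cyc_term q 0 N s%:Z (cyc_emb f).

Lemma cyc_totalE s : cyc_total s = q ^ (s%:Z * slope) * scale
  * (omit_det (@sect K q p N) 0 n)`_s.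
Proof.
rewrite coef_omit_det mulr_sumr; apply: eq_bigr => f /eqP fs.
rewrite cyc_term_emb //; congr (_ * (_ * _)).
by apply: eq_bigr => i _; rewrite expr0 mulr1.
Qed.

(** For fixed j the gaps j - i run over 1, ..., j. *)
Lemma prod_gap :
  \prod_(i < n) \prod_(j < n | (i < j)%N) (1 - q ^+ (j - i)) = \prod_(j < n) poch j%:Z.
Proof.
rewrite (exchange_big_dep xpredT) //=; apply: eq_bigr => j _.
rewrite -(big_ord_widen n (fun i => 1 - q ^+ (j - i))); last exact: ltnW.
rewrite (reindex_inj rev_ord_inj) big_mkord /=; apply: eq_bigr => i _.
by rewrite subKn ?ltn_ord // exprS.
Qed.

(** Supplies the constant coefficient that [coef_omit_det0] leaves free. Only f = 0 contributes, and
    its Vandermonde factor, by [prod_gap], cancels the (q;q)_i in the denominators. *)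
Lemma cyc_total0 : cyc_total 0 = 1.
Proof.
have f0 (f : {ffun 'I_n -> 'I_N.+1}) : (\sum_i f i == 0)%N = (f == [ffun=> ord0]).
  apply/idP/eqP => [|->]; last by rewrite big1 // => i _; rewrite ffunE.
  rewrite sum_nat_eq0 => /forallP h; apply/ffunP => i; rewrite ffunE.
  by apply: val_inj; apply/eqP; exact: h.
rewrite /cyc_total (eq_bigl _ _ f0) big_pred1_eq /cyc_term cyc_quot_emb.
set f := finfun _.
have fE i : (f i : nat) = 0%N by rewrite ffunE.
have eE i : cyc_emb f i = 0 by rewrite [LHS]ffunE fE.
have -> : cyc_exp (cyc_emb f) = 0.
  by rewrite /cyc_exp !big1 ?mulr0 // => i _; rewrite eE ?mulr0.
have -> : cyc_vdm q (cyc_emb f) = \prod_(i < n) \prod_(j < n | (i < j)%N) (1 - q ^+ (j - i)).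
  apply: eq_bigr => i _; apply: eq_bigr => j ij; rewrite !eE exprnP.
  by congr (1 - q ^ _); lia.
rewrite prod_gap mulr0 !expr0z !mul1r.
rewrite !big_split.
have -> : \prod_(i < n) iq (n * f i + i)%N%:Z = (\prod_(i < n) poch i%:Z)^-1.
  by rewrite -prodfV; apply: eq_bigr => i _; rewrite fE muln0.
have -> : \prod_(i < n) iq (N%:Z + p%:Z - (n * f i + i)%N%:Z)
    = (\prod_(i < n) poch (N%:Z + i%:Z))^-1.
  rewrite -prodfV (reindex_inj rev_ord_inj); apply: eq_bigr => i _.
  rewrite fE muln0 add0n; congr (_^-1); apply: congr1.
  by rewrite /=; have := ltn_ord i; lia.
have h1 : \prod_(i < n) poch i%:Z != 0 by apply/prodf_neq0 => i _; exact: qpoch_neq0.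
have h2 : \prod_(i < n) poch (N%:Z + i%:Z) != 0.
  by apply/prodf_neq0 => i _; rewrite -PoszD; exact: qpoch_neq0.
move: (\prod_(i < n) _) (\prod_(i < n) _) h1 h2 => a b a0 b0.
by rewrite /=; field; rewrite a0 b0.
Qed.

Lemma cyc_total_closed s :
  cyc_total s = q ^ ((n%:Z + 1) * 'C(s.+1, 2)%:Z)
    * (poch N%:Z * (iq s%:Z * iq (N%:Z - s%:Z))).
Proof.
have t0 := cyc_total0; move: t0; rewrite cyc_totalE mul0r expr0z mul1r => t0.
rewrite cyc_totalE coef_omit_det0 // qbinE //.
transitivity (q ^ (s%:Z * slope) * q ^+ (n * 'C(s, 2) + 'C(n, 2) * s) * q ^+ 'C(s, 2)
  * (scale * (omit_det (sect q N (p:=p)) 0 n)`_0)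
  * (poch N%:Z * (iq s%:Z * iq (N%:Z - s%:Z)))); first by ring.
rewrite t0 mulr1; congr (_ * _); rewrite !(exprnP q) -!expfzDr //; congr (_ ^ _).
rewrite /slope (binS s) bin1 (binS n) bin1.
have h := mul2_bin2 p; move: 'C(n, 2) 'C(s, 2) h => c2 cs h.
have -> : n%:Z * p%:Z = 2 * c2%:Z by lia.
rewrite !(PoszM, PoszD); ring.
Qed.

(** Outside the box 0 <= k_i <= N some denominator has a negative index, so the quotient
    vanishes. *)
Lemma cyc_sum0 (s : nat) : cyc_sum q p 0 N s%:Z = cyc_total s.
Proof.
pose r := [seq cyc_emb f | f <- enum [pred f : {ffun 'I_n -> 'I_N.+1} | (\sum_i f i == s)%N]].
have emb_inj : injective cyc_emb.
  move=> f g /ffunP e; apply/ffunP => i; apply: val_inj.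
  by have := e i; rewrite !ffunE => -[].
rewrite /cyc_sum (@fsbigE _ _ _ _ _ r).
- rewrite /r big_map big_enum_cond; apply: eq_bigl => f.
  rewrite [f \in _]inE; case: eqP => // fs /=.
  by apply/mem_set; rewrite /= cyc_emb_sum fs.
- by rewrite map_inj_uniq ?enum_uniq.
- by move=> k /= /mapP[f]; rewrite mem_enum inE => /eqP fs ->; rewrite cyc_emb_sum fs.
move=> k /= ks kr; rewrite /cyc_term.
suff -> : cyc_quot q 0 N k = 0 by rewrite mulr0.
have [/forallP kin|/forallPn[i ki]] := boolP [forall i, (0 <= k i) && (k i <= N%:Z)].
  have kE i : (inord `|k i|%N : 'I_N.+1)%:Z = k i.
    have /andP[k0 kN] := kin i.
    by rewrite inordK ?gez0_abs // ltnS -lez_nat gez0_abs.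
  case/negP: kr; apply/mapP; exists [ffun i => inord `|k i|%N]; last first.
    by apply/ffunP => i; rewrite !ffunE kE.
  rewrite mem_enum inE -eqz_nat -ks (big_morph Posz PoszD (erefl _)).
  by apply/eqP; apply: eq_bigr => i _; rewrite ffunE kE.
rewrite /cyc_quot (bigD1 i) //= invfM.
have li := ltn_ord i.
have [k0|k0] := ltP (k i) 0.
  have h : n%:Z * (k i + 1) <= 0 by rewrite mulr_ge0_le0 //; lia.
  rewrite (iq_neg q_neq0 (z := 0%:Z + _ + _ - _)) ?mul0r ?mulr0 ?mul0r //.
  by rewrite mulrDr in h; move: h li; move: (n%:Z * k i) => x; lia.
have {}ki : N%:Z + 1 <= k i by move: ki; rewrite k0 /= -ltNge; lia.
have h1 : 0 <= n%:Z * (k i - N%:Z - 1) by rewrite mulr_ge0 //; lia.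
have h2 : 0 <= p%:Z * N%:Z by rewrite mulr_ge0.
rewrite (iq_neg q_neq0 (z := N%:Z - _ + _ - _)) ?mulr0 ?mul0r //.
have {}h1 : n%:Z * N%:Z + n%:Z <= n%:Z * k i by rewrite !mulrBr in h1; lia.
move: h1; rewrite (_ : n%:Z * N%:Z = p%:Z * N%:Z + N%:Z); last by lia.
by move: h2 li; move: (n%:Z * k i) (p%:Z * N%:Z) => x y; lia.
Qed.

End ZeroLowerBound.

(** * Descent to M1 = 0 and the theorem *)

Lemma divz_triangular_nat (s : nat) : (s%:Z * (s%:Z + 1) %/ 2)%Z = 'C(s.+1, 2)%:Z.
Proof.
have := mul2_bin2 s => h.
rewrite (_ : s%:Z * (s%:Z + 1) = 'C(s.+1, 2)%:Z * 2) ?mulzK //.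
by move: h; move: 'C(_, _) => c h; lia.
Qed.

Lemma divz_triangularS (S : int) :
  ((S + 1) * (S + 1 + 1) %/ 2)%Z = (S * (S + 1) %/ 2)%Z + (S + 1).
Proof.
rewrite (_ : (S + 1) * (S + 1 + 1) = (S + 1) * 2 + S * (S + 1)); last by ring.
by rewrite divzMDl // addrC.
Qed.

(** Induction on M1 for all M2 and S: the rotation passes to (M1 - 1, M2 + 1, S + 1), preserving -
    M1 <= S, and its factor q^((n + 1) (S + 1)) is the quotient of the triangular powers at S + 1
    and S. *)
Lemma cyc_sum_closed (K : fieldType) (q : K) (p M1 M2 : nat) (S : int) :
  q != 0 -> (forall j, (0 < j)%N -> q ^+ j != 1) -> - M1%:Z <= S ->
  cyc_sum q p M1 M2 S
  = q ^ ((p.+1%:Z + 1) * (S * (S + 1) %/ 2)%Z)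
    * (qpoch q q (M1%:Z + M2%:Z)
       / (qpoch q q (M1%:Z + S) * qpoch q q (M2%:Z - S))).
Proof.
move=> q0 qa; elim: M1 M2 S => [|M1 IH] M2 S MS.
  case: S MS => // s _.
  by rewrite cyc_sum0 // cyc_total_closed // divz_triangular_nat !add0r invfM.
have := IH M2.+1 (S + 1); rewrite cyc_sum_rot // => /(_ _) h.
apply: (mulfI (expfz_neq0 ((p.+1%:Z + 1) * (S + 1)) q0)).
rewrite h; last by lia.
rewrite (_ : M1%:Z + M2.+1%:Z = M1.+1%:Z + M2%:Z); last by lia.
rewrite (_ : M1%:Z + (S + 1) = M1.+1%:Z + S); last by lia.
rewrite (_ : M2.+1%:Z - (S + 1) = M2%:Z - S); last by lia.
by rewrite divz_triangularS mulrDr expfzDr // -mulrA mulrCA.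
Qed.

Lemma indet_neq0 (F : fieldType) : indet F != 0.
Proof. by rewrite /indet tofrac_eq0 polyX_eq0. Qed.

Lemma indet_aperiodic (F : fieldType) j : (0 < j)%N -> indet F ^+ j != 1.
Proof.
move=> j0; rewrite /indet -tofracXn -tofrac1 tofrac_eq.
apply: contraL j0 => /eqP/(congr1 (fun r : {poly F} => size r)).
by rewrite size_polyXn size_poly1 => -[->].
Qed.

(* The index i : 'I_n stands for the paper's index i.+1 in {1, ..., n}.
   The sum over Z^n is the library's finitely supported sum; its default value
   for an infinite support is 0, while the right-hand side is nonzero, so the
   equation also entails that the support is finite. *)
Theorem mainTheorem1 (F : fieldType) (n M1 M2 : nat) (S : int)
    (hn : (0 < n)%N) (hS : - M1%:Z <= S <= M2%:Z) :
  let q : ratfun F := indet F in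
  \sum_(k \in [set k : {ffun 'I_n -> int} | \sum_(i < n) k i = S])
    ((-1) ^ ((n%:Z - 1) * S)
     * q ^ ('C(n.+1, 2)%:Z * (\sum_(i < n) k i ^+ 2)
            + \sum_(i < n) i.+1%:Z * k i)
     * (\prod_(i < n) \prod_(j < n | (i < j)%N)
          (1 - q ^ (n%:Z * k j - n%:Z * k i + j.+1%:Z - i.+1%:Z)))
     * \prod_(i < n)
          (qpoch q q (M1%:Z + M2%:Z + i.+1%:Z - 1)
           / (qpoch q q (M1%:Z + n%:Z * k i + i.+1%:Z - 1)
              * qpoch q q (M2%:Z - n%:Z * k i + n%:Z - i.+1%:Z))))
  = q ^ ((n%:Z + 1) * (S * (S + 1) %/ 2)%Z)
    * (qpoch q q (M1%:Z + M2%:Z)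
       / (qpoch q q (M1%:Z + S) * qpoch q q (M2%:Z - S))).
Proof.
move=> q; case: n hn => // p _; case/andP: hS => MS _.
exact: (cyc_sum_closed p M2 (indet_neq0 F) (@indet_aperiodic F) MS).
Qed.
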